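(* Let $v\ge 1$ and $0\le e\le\binom v2$ be integers, and let $G$ be an optimal graph in $\mathcal G(v,e)$. Then $G=\mathrm{Th}(\pi)$ for some partition $\pi\in\mathrm{Dis}(v,e)$, and the diagonal sequence $\delta(\pi)$ equals the diagonal sequence of either the quasi-star partition or the quasi-complete partition in $\mathrm{Dis}(v,e)$.
   Context: $\mathcal G(v,e)$ is the set of simple graphs with $v$ vertices and $e$ edges. For a graph with degrees $d_1,\dots,d_v$, $P_2(G)=\sum_i d_i^2$. A graph $G\in\mathcal G(v,e)$ is optimal if $P_2(G)$ is maximal over $\mathcal G(v,e)$. $\mathrm{Dis}(v,e)$ is the set of partitions $\pi=(a_0,a_1,\dots,a_p)$ of $e$ into distinct parts with $v>a_0>a_1>\dots>a_p>0$ (the empty partition if $e=0$). The threshold graph $\mathrm{Th}(\pi)$ has vertex set $\{0,1,\dots,v-1\}$ and, for each $s=0,\dots,p$, the edges $\{s,s+1\},\{s,s+2\},\dots,\{s,s+a_s\}$; it lies in $\mathcal G(v,e)$. The diagonal sequence of $\pi$ is $\delta(\pi)=(\delta_1,\dots,\delta_T)$, where $\delta_i$ is the number of pairs $(s,t)$ with $0\le s\le p$, $s+1\le t\le s+a_s$ and $s+t=i$, and $T$ is the largest such value of $s+t$. Write $e=\binom{k+1}{2}-j$ with integers $1\le j\le k$ (unique); the quasi-complete partition is $(k,k-1,\dots,\widehat{j},\dots,2,1)$ (all integers from $k$ down to $1$ except $j$). Write $e=\binom v2-\binom{k'+1}2+j'$ with integers $1\le j'\le k'$ (unique); the quasi-star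 partition is $(v-1,v-2,\dots,k'+1,j')$. *)

(* Defs.v *)
From mathcomp Require Import all_boot fingroup perm.

Set Implicit Arguments.
Unset Strict Implicit.
Unset Printing Implicit Defensive.

(* Simple graphs with labelled vertex set {0, ..., v-1}. *)
Record sgraph (v : nat) := SGraph {
  adj :> rel 'I_v;
  adj_sym : symmetric adj;
  adj_irr : irreflexive adj
}.

(* Each edge {x, y} is counted once, through its representative x < y. *)
Definition num_edges (v : nat) (G : sgraph v) : nat :=
  #|[set p : 'I_v * 'I_v | (p.1 < p.2) && G p.1 p.2]|.

Definition degree (v : nat) (G : sgraph v) (x : 'I_v) : nat :=
  #|[set y | G x y]|.

Definition P2 (v : nat) (G : sgraph v) : nat := \sum_(x < v) degree G x ^ 2.

Definition optimal (v e : nat) (G : sgraph v) : Prop :=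
  num_edges G = e /\
  forall H : sgraph v, num_edges H = e -> P2 H <= P2 G.

Definition isomorphic (v : nat) (G H : sgraph v) : Prop :=
  exists f : {perm 'I_v}, forall x y, G x y = H (f x) (f y).

Definition Dis (v e : nat) (pi : seq nat) : bool :=
  [&& sorted gtn pi, all (fun a => 0 < a < v) pi & sumn pi == e].

(* For s >= size pi the default value 0 of nth makes the condition false. *)
Definition th_arc (pi : seq nat) (s t : nat) : bool :=
  s < t <= s + nth 0 pi s.

Definition th_adj (v : nat) (pi : seq nat) : rel 'I_v :=
  fun x y => th_arc pi x y || th_arc pi y x.

Lemma th_adj_sym (v : nat) (pi : seq nat) : symmetric (@th_adj v pi).
Proof. by move=> x y; rewrite /th_adj orbC. Qed.

Lemma th_adj_irr (v : nat) (pi : seq nat) : irreflexive (@th_adj v pi).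
Proof. by move=> x; rewrite /th_adj /th_arc ltnn. Qed.

(* When pi is in Dis v e, s + a_s < v for every s, so that restricting the
   endpoints to 'I_v loses no edge. *)
Definition Th (v : nat) (pi : seq nat) : sgraph v :=
  SGraph (@th_adj_sym v pi) (@th_adj_irr v pi).

Definition th_pairs (pi : seq nat) : seq (nat * nat) :=
  [seq (s, t) | s <- iota 0 (size pi), t <- iota s.+1 (nth 0 pi s)].

Definition diag_count (pi : seq nat) (i : nat) : nat :=
  count (fun st => st.1 + st.2 == i) (th_pairs pi).

Definition diag_length (pi : seq nat) : nat :=
  \max_(st <- th_pairs pi) (st.1 + st.2).

Definition diag_seq (pi : seq nat) : seq nat :=
  [seq diag_count pi i | i <- iota 1 (diag_length pi)].

Definition quasi_complete (e : nat) (rho : seq nat) : Prop :=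
  exists k j : nat,
    [/\ 1 <= j <= k, e + j = 'C(k.+1, 2) &
        rho = [seq i <- rev (iota 1 k) | i != j]].

(* (v-1, v-2, ..., k+1, j).  For e = 0 the unique solution is k = j = v, where
   the range v-1, ..., k+1 is meaningless (formally it sums to -v); the
   partition meant is then the only element of Dis v 0, the empty one. *)
Definition quasi_star (v e : nat) (rho : seq nat) : Prop :=
  exists k j : nat,
    [/\ 1 <= j <= k, e + 'C(k.+1, 2) = 'C(v, 2) + j &
        rho = if e == 0 then [::]
              else rcons (rev (iota k.+1 (v - k.+1))) j].

(* Main.v *)
(* Moving an edge yz to xz when deg y <= deg x increases P2, so in an optimal
   graph the neighbourhoods are nested and G = Th pi.  Moreover P2 (Th pi) is
   twice the sum of the ranks s + t of the cells (s, t) of pi, and the diagonal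
   sequence is the multiset of these ranks.

   So let pi have the largest rank sum among the partitions of e into distinct
   parts at most n = v - 1; argue by induction on n.  If n is a part, the
   remaining parts are optimal for n - 1, hence have the ranks of a quasi-star
   (then so does pi) or of a quasi-complete partition with parameters k, j.  In
   the latter case, moving cells of (n, k, ..., j^, ..., 1) increases the rank
   sum unless the ranks are already those of one of the two extremal partitions:
   if n <= k + j, the tail of row 0 is moved into column k + 1; if n > k + j,
   moving j cells in this way forces n > 2k, and then row 1 can be lengthened
   at the expense of the last column.  If n is not a part, pass to the
   complement of pi in {1, ..., n}, which exchanges quasi-stars and
   quasi-complete partitions. *)
Require Import Defs.
From mathcomp Require Import all_boot fingroup perm zify.

Set Implicit Arguments.
Unset Strict Implicit.
Unset Printing Implicit Defensive.

(** * Cell sets of partitions and their ranks *)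

Definition desc (n : nat) (pi : seq nat) : bool :=
  sorted gtn pi && all (fun a => 0 < a <= n) pi.

Definition stair (k : nat) : seq nat := rev (iota 1 k).

Definition qc (k j : nat) : seq nat := [seq i <- stair k | i != j].

(** Here [n] stands for [v - 1]; for [k = n] only the part [j] is left. *)
Definition qs (n k j : nat) : seq nat := rcons (rev (iota k.+1 (n - k))) j.

Definition compl (n : nat) (pi : seq nat) : seq nat :=
  [seq i <- stair n | i \notin pi].

Definition ranks (pi : seq nat) : seq nat :=
  [seq st.1 + st.2 | st <- th_pairs pi].

(** Half of [P2] of the threshold graph, by [P2_Th]. *)
Definition wt (pi : seq nat) : nat := sumn (ranks pi).

(** The cells below row 0 are those of [pi] moved by (1, 1), which adds 2 to each rank. *)
Lemma ranks_cons a pi : ranks (a :: pi) = iota 1 a ++ map (addn 2) (ranks pi).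
Proof.
rewrite /ranks /th_pairs /= map_cat -map_comp; congr (_ ++ _).
  by rewrite -[RHS]map_id; apply: eq_map.
rewrite -[1]addn0 iotaDl !map_flatten -!map_comp; congr flatten.
apply: eq_map => s /=; rewrite -!map_comp -[(1 + s).+1]addnS iotaDl -map_comp.
by apply: eq_map => t /=; lia.
Qed.

Lemma size_ranks pi : size (ranks pi) = sumn pi.
Proof.
by elim: pi => // a pi IH; rewrite ranks_cons size_cat size_iota size_map IH.
Qed.

Lemma sumn_addn c s : sumn (map (addn c) s) = c * size s + sumn s.
Proof. by elim: s => [|x s IH] /=; [rewrite muln0 | rewrite IH; lia]. Qed.

Lemma sumn_iota a c : 2 * sumn (iota a c) + c = c * (2 * a + c).
Proof. by elim: c a => // c IH a /=; have := IH a.+1; nia. Qed.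

Lemma wt_cons a pi : wt (a :: pi) = sumn (iota 1 a) + (2 * sumn pi + wt pi).
Proof. by rewrite /wt ranks_cons sumn_cat sumn_addn size_ranks. Qed.

Lemma perm_sumn (s t : seq nat) : perm_eq s t -> sumn s = sumn t.
Proof. by move=> st; rewrite !sumnE; apply: perm_big. Qed.

Lemma stairS k : stair k.+1 = k.+1 :: stair k.
Proof. by rewrite /stair -[in iota 1 k.+1](addn1 k) iotaD rev_cat. Qed.

Lemma mem_stair k i : (i \in stair k) = (0 < i <= k).
Proof. by rewrite /stair mem_rev mem_iota add1n ltnS. Qed.

Lemma qcS k j : j <= k -> qc k.+1 j = k.+1 :: qc k j.
Proof. by move=> jk; rewrite /qc stairS /= ifT //; lia. Qed.

Lemma qc_id k j : ~~ (0 < j <= k) -> qc k j = stair k.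
Proof.
move=> jk; apply/all_filterP/allP => i; rewrite mem_stair.
by apply: contraTN => /eqP ->.
Qed.

Lemma qcSS k : qc k.+1 k.+1 = stair k.
Proof. by rewrite -(@qc_id k k.+1) ?ltnn // /qc stairS /= eqxx. Qed.

(** As a cell set, [qc k.+1 j] is [stair k] together with the top [k.+1 - j] cells of column [k.+1],
    whose ranks start at [k.+1]. *)
Lemma ranks_qc k j : j <= k.+1 ->
  perm_eq (ranks (qc k.+1 j)) (ranks (stair k) ++ iota k.+1 (k.+1 - j)).
Proof.
elim: k => [|k IH]; first by case: j => [|[|]].
rewrite leq_eqVlt => /predU1P [->|jk]; first by rewrite qcSS subnn cats0.
rewrite qcS // ranks_cons stairS ranks_cons subSn //.
have := perm_map (addn 2) (IH jk); rewrite map_cat -iotaDl => /seq.permP IH2.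
apply/seq.permP => p; move: (IH2 p).
rewrite -[in iota 1 k.+2](addn1 k.+1) iotaD !count_cat /= !add1n !add2n; lia.
Qed.

(** * Partitions with bounded parts and their complements *)

Lemma desc_cons n a pi : a <= n -> desc n (a :: pi) = (0 < a) && desc a.-1 pi.
Proof.
move=> an; rewrite /desc /= an andbT.
rewrite path_sortedE; last by move=> x y z; rewrite /gtn /=; lia.
case: a an => [|a] an; first by rewrite andbF.
rewrite /= -andbA andbC -andbA; congr (_ && _); rewrite -all_predI.
by apply: eq_all => x /=; lia.
Qed.

Lemma desc_le n m pi : n <= m -> desc n pi -> desc m pi.
Proof.
rewrite /desc => nm /andP [-> /allP al] /=; apply/allP => x /al; lia.
Qed.

Lemma descS n pi : desc n.+1 pi ->
  desc n pi \/ exists2 pi', pi = n.+1 :: pi' & desc n pi'.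
Proof.
case: pi => [|a pi]; first by left.
case: (ltngtP a n.+1) => [an | an | ->]; last by rewrite desc_cons //; right; exists pi.
  by rewrite !desc_cons //; [left | lia].
by rewrite /desc /=; lia.
Qed.

Lemma desc0 pi : desc 0 pi -> pi = [::].
Proof. by case: pi => // a pi; rewrite /desc /=; lia. Qed.

Lemma desc_notin n m pi : n < m -> desc n pi -> m \notin pi.
Proof. by move=> nm /andP [_ /allP al]; apply/negP => /al; lia. Qed.

Lemma compl_cons n pi : compl n.+1 (n.+1 :: pi) = compl n pi.
Proof.
rewrite /compl stairS /= inE eqxx /=; apply: eq_in_filter => i.
by rewrite mem_stair inE => /andP [_ le_in]; rewrite negb_or neq_ltn ltnS le_in.
Qed.

Lemma compl_skip n pi : desc n pi -> compl n.+1 pi = n.+1 :: compl n pi.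
Proof. by move=> dpi; rewrite /compl stairS /= (desc_notin _ dpi). Qed.

(** A subset of {1, ..., n} is built by deciding in turn whether 1, ..., n belong to it;
    [compl_skip] and [compl_cons] follow these two cases. *)
Lemma desc_ind_top (P : nat -> seq nat -> Prop) :
  P 0 [::] ->
  (forall n pi, desc n pi -> P n pi -> P n.+1 pi) ->
  (forall n pi, desc n pi -> P n pi -> P n.+1 (n.+1 :: pi)) ->
  forall n pi, desc n pi -> P n pi.
Proof.
move=> P0 Pskip Pcons; elim=> [|n IH] pi; first by move=> /desc0 ->.
by move=> /descS [d | [pi' -> d]]; [apply: Pskip | apply: Pcons] => //; apply: IH.
Qed.

Lemma desc_compl n pi : desc n pi -> desc n (compl n pi).
Proof.
move: n pi; apply: desc_ind_top => // n pi d IH.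
  by rewrite compl_skip // desc_cons.
by rewrite compl_cons; apply: desc_le IH.
Qed.

Lemma complK n pi : desc n pi -> compl n (compl n pi) = pi.
Proof.
move: n pi; apply: desc_ind_top => // n pi d IH.
  by rewrite (compl_skip d) compl_cons.
by rewrite compl_cons compl_skip ?desc_compl // IH.
Qed.

(** The half turn of the staircase sends row 0, of ranks 1, ..., [m], to column [m], of ranks [m],
    ..., [2 * m - 1]. *)
Lemma perm_rev_iota m : perm_eq (map (subn (2 * m)) (iota 1 m)) (iota m m).
Proof.
apply: uniq_perm; last first.
- move=> x; apply/mapP/idP => [[i]|]; rewrite !mem_iota; first by lia.
  by move=> xm; exists (2 * m - x); rewrite ?mem_iota; lia.
- exact: iota_uniq.
rewrite map_inj_in_uniq ?iota_uniq // => i j; rewrite !mem_iota; lia.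
Qed.

(* The complement of a cell set, turned around by (s, t) |-> (n - t, n - s), is
   the cell set of the complementary partition. *)
Lemma ranks_compl n pi : desc n pi ->
  all (fun r => r <= 2 * n) (ranks (compl n pi)) /\
  perm_eq (ranks pi ++ map (subn (2 * n)) (ranks (compl n pi))) (ranks (stair n)).
Proof.
move: n pi; apply: desc_ind_top => // n pi d [bnd IH].
  rewrite compl_skip // ranks_cons map_cat all_cat -map_comp; split.
    apply/andP; split; first by apply/allP => i; rewrite mem_iota; lia.
    by rewrite all_map; apply: sub_all bnd => r /=; lia.
  rewrite (_ : map (_ \o _) _ = map (subn (2 * n)) (ranks (compl n pi))); last first.
    by apply: eq_map => r /=; lia.
  (* For [j = 0] nothing is deleted, so this splits column [n.+1] off the staircase. *)
  have := ranks_qc (leq0n n.+1); rewrite qc_id // subn0.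
  move: IH (perm_rev_iota n.+1) => /seq.permP IH /seq.permP rv /seq.permP st.
  by apply/seq.permP => p; move: (IH p) (rv p) (st p); rewrite !count_cat; lia.
rewrite compl_cons ranks_cons stairS ranks_cons; split.
  by apply: sub_all bnd => r /=; lia.
rewrite -catA perm_cat2l.
rewrite (_ : map (subn (2 * n.+1)) _ = map (addn 2) (map (subn (2 * n)) (ranks (compl n pi)))).
  by rewrite -map_cat; apply: perm_map.
by rewrite -map_comp; apply/eq_in_map => r /(allP bnd) /=; lia.
Qed.

Lemma wt_compl n pi : desc n pi ->
  wt pi + 2 * n * sumn (compl n pi) = wt (stair n) + wt (compl n pi).
Proof.
move=> /ranks_compl [bnd /perm_sumn]; rewrite /wt => <-; rewrite sumn_cat.
rewrite -[sumn (compl n pi)]size_ranks -!addnA; congr (_ + _).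
elim: (ranks _) bnd => [|r s IH] /=; first by rewrite muln0.
by move=> /andP [? /IH]; lia.
Qed.

Lemma sumn_compl n pi : desc n pi -> sumn pi + sumn (compl n pi) = sumn (stair n).
Proof.
by move=> /ranks_compl [_ /perm_size]; rewrite size_cat !size_ranks size_map size_ranks.
Qed.

(** The ranks missing from the staircase, reflected by [r |-> 2 * n - r], are the ranks of the
    complement. The bound on the ranks makes this truncated reflection an involution. *)
Lemma perm_ranks_compl n pi rho : desc n pi -> desc n rho ->
  perm_eq (ranks pi) (ranks rho) ->
  perm_eq (ranks (compl n pi)) (ranks (compl n rho)).
Proof.
move=> dpi drho eqr.
have [bpi cpi] := ranks_compl dpi; have [brho crho] := ranks_compl drho.
have invol s : all (fun r => r <= 2 * n) s ->
    map (subn (2 * n)) (map (subn (2 * n)) s) = s.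
  move=> b; rewrite -map_comp -[RHS]map_id; apply/eq_in_map => r /(allP b) /=; lia.
rewrite -(invol _ bpi) -(invol _ brho); apply: perm_map.
rewrite -(perm_cat2l (ranks pi)); apply: perm_trans cpi _; rewrite perm_sym.
by apply: perm_trans crho; rewrite perm_cat2r.
Qed.

(** * Sums and complements of quasi-complete and quasi-star partitions *)

Lemma sumn_stair k : sumn (stair k) = 'C(k.+1, 2).
Proof.
by elim: k => // k IH; rewrite stairS /= IH [in RHS]binS bin1 addnC.
Qed.

Lemma desc_stair k : desc k (stair k).
Proof. by elim: k => // k IH; rewrite stairS desc_cons. Qed.

Lemma desc_qc k j : desc k (qc k j).
Proof.
elim: k => // k IH; rewrite /qc stairS /= -/(qc k j); case: eqP => _.
  by apply: desc_le IH.
by rewrite desc_cons.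
Qed.

Lemma sumn_qc k j : 0 < j <= k -> sumn (qc k j) + j = 'C(k.+1, 2).
Proof.
elim: k => [|k IH] jk; first by lia.
case: (leqP j k) => [jk'|kj]; last first.
  by have -> : j = k.+1; [lia | rewrite qcSS sumn_stair [in RHS]binS bin1].
by rewrite qcS // [in RHS]binS bin1 -IH /=; lia.
Qed.

Lemma qsS n k j : k <= n -> qs n.+1 k j = n.+1 :: qs n k j.
Proof.
by move=> kn; rewrite /qs subSn // -[(n - k).+1]addn1 iotaD rev_cat /= addSn subnKC.
Qed.

Lemma compl_qc n k j : 0 < j <= k -> k <= n -> compl n (qc k j) = qs n k j.
Proof.
move=> jk; elim: n => [|n IH]; first by lia.
rewrite leq_eqVlt => /predU1P [kn | kn]; last first.
  by rewrite compl_skip ?qsS ?IH //; apply: desc_le (desc_qc k j).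
rewrite -{}kn {IH n} /qs subnn /=.
elim: k jk => [|k IH] jk; first by lia.
case: (leqP j k) => [jk'|kj]; first by rewrite qcS // compl_cons; apply: IH; lia.
have -> : j = k.+1 by lia.
rewrite qcSS compl_skip ?desc_stair //; congr (_ :: _).
by rewrite -[stair k](@qc_id k 0) //; elim: k {IH jk kj} => // k IH; rewrite qcS // compl_cons.
Qed.

Lemma desc_qs n k j : 0 < j <= k -> k <= n -> desc n (qs n k j).
Proof.
by move=> jk kn; rewrite -compl_qc //; apply/desc_compl/desc_le/desc_qc.
Qed.

Lemma compl_qs n k j : 0 < j <= k -> k <= n -> compl n (qs n k j) = qc k j.
Proof.
by move=> jk kn; rewrite -compl_qc // complK //; apply/desc_le/desc_qc.
Qed.

Lemma sumn_qs n k j : 0 < j <= k -> k <= n ->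
  sumn (qs n k j) + 'C(k.+1, 2) = 'C(n.+1, 2) + j.
Proof.
move=> jk kn; have := sumn_compl (desc_qs jk kn).
by rewrite compl_qs // sumn_stair -(sumn_qc jk); lia.
Qed.

(** * Partitions of maximal weight *)

Definition opt (n : nat) (pi : seq nat) : Prop :=
  desc n pi /\
  forall sigma, desc n sigma -> sumn sigma = sumn pi -> wt sigma <= wt pi.

(** Different optimal partitions can share their ranks, such as 3 and 2 + 1, so only ranks are
    compared. Both alternatives use the same [k] and [j] because [compl n] exchanges [qs n k j] and
    [qc k j]. *)
Definition extremal (n : nat) (pi : seq nat) : Prop :=
  exists k j, [/\ 0 < j <= k, k <= n &
    perm_eq (ranks pi) (ranks (qs n k j)) \/ perm_eq (ranks pi) (ranks (qc k j))].

Lemma wt_qc k j : j <= k.+1 ->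
  wt (qc k.+1 j) = wt (stair k) + sumn (iota k.+1 (k.+1 - j)).
Proof. by move=> /ranks_qc /perm_sumn; rewrite sumn_cat. Qed.

Lemma wt_stair k : wt (stair k.+1) = wt (stair k) + sumn (iota k.+1 k.+1).
Proof. by have := wt_qc (leq0n k.+1); rewrite qc_id // subn0. Qed.

Lemma sumn_qcE k j : j <= k -> sumn (qc k j) + j = sumn (stair k).
Proof.
case: j => [|j] jk; first by rewrite qc_id // addn0.
by rewrite sumn_qc // sumn_stair.
Qed.

Lemma sumn_iotaD a b c : sumn (iota a (b + c)) = sumn (iota a b) + sumn (iota (a + b) c).
Proof. by rewrite iotaD sumn_cat. Qed.

Lemma sumn_iotaE a c : sumn (iota a c) = a * c + 'C(c, 2).
Proof.
rewrite -[a in iota a c]addn0 iotaDl sumn_addn size_iota; congr (_ + _).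
by elim: c => // c IH; rewrite -[in LHS](addn1 c) sumn_iotaD IH binS bin1 /= addn0.
Qed.

(** Row 0 has [m = n - k.+1] cells beyond column [k.+1], fewer than the [j] cells which that column
    lacks. Moving them there gives [qc k.+1 (j - m)]. *)
Lemma opt_cons_qc_short n k j : 0 < j <= k -> k < n <= k + j ->
  opt n (n :: qc k j) -> extremal n (n :: qc k j).
Proof.
move=> /andP [j0 jk] /andP [kn nkj] [_ opt_pi].
have [m Dn] : exists m, n = k.+1 + m by exists (n - k.+1); lia.
case: k => [|k] in jk kn nkj opt_pi Dn *; first by lia.
have split_n : iota 1 n = iota 1 k.+2 ++ iota (1 + k.+2) m by rewrite Dn iotaD.
have [jk' | kj] := ltnP j k.+1.
  (* moving m cells gains m (k - j), in terms of the k of the statement *)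
  suff m0 : m = 0.
    exists k.+2, j; split; [by lia | by lia | right].
    have -> : n = k.+2 by lia.
    by rewrite (@qcS k.+1 j) //; lia.
  have := opt_pi (qc k.+2 (j - m)); rewrite qcS; last by lia.
  rewrite !wt_cons !wt_qc ?desc_cons ?desc_qc //; try by lia.
  have := sumn_qcE jk; have jm : j - m <= k.+1 by lia.
  have := sumn_qcE jm.
  rewrite split_n sumn_cat (_ : k.+1 - (j - m) = k.+1 - j + m); last by lia.
  rewrite sumn_iotaD !(sumn_iotaE _ m) => sq1 sq2.
  move=> leW; have {}leW := leW isT ltac:(move=> /=; lia).
  suff /eqP : m * (k.+1 - j) = 0 by rewrite muln_eq0; lia.
  by move: (k.+1 - j) leW => d; nia.
(* Now the gain is zero: each cell moves within its own diagonal, so the ranks are already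
   quasi-complete. *)
have Dj : j = k.+1 by lia.
exists k.+2, (j - m); split; [by lia | by lia | right].
rewrite (@qcS k.+1); last by lia.
rewrite !ranks_cons Dj qcSS split_n -catA perm_cat2l.
have jm : k.+1 - m <= k.+1 by lia.
have := perm_map (addn 2) (ranks_qc jm); rewrite subKn; last by lia.
rewrite map_cat -iotaDl perm_sym perm_catC add2n add1n.
exact.
Qed.

Lemma opt_cons_qc_long n k j : 0 < j <= k -> k + j < n ->
  opt n (n :: qc k j) -> extremal n (n :: qc k j).
Proof.
move=> /andP [j0 jk] nkj [_ opt_pi].
have n2k : 2 * k < n.
  case: k => [|k] in jk nkj opt_pi *; first by lia.
  (* gain j (2k + 1 - n), in terms of the k of the statement *)
  have leW : wt (n - j :: stair k.+1) <= wt (n :: qc k.+1 j).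
    apply: opt_pi; last by rewrite /= -(sumn_qcE jk); lia.
    rewrite desc_cons ?leq_subr // (desc_le _ (desc_stair k.+1)); lia.
  move: leW; rewrite !wt_cons wt_qc // wt_stair -(sumn_qcE jk).
  have split_n : iota 1 n = iota 1 (n - j) ++ iota (1 + (n - j)) j.
    by rewrite -iotaD subnK //; lia.
  have split_k : iota k.+1 k.+1 = iota k.+1 (k.+1 - j) ++ iota (k.+1 + (k.+1 - j)) j.
    by rewrite -iotaD subnK //; lia.
  rewrite split_n split_k !sumn_cat !(sumn_iotaE _ j) => leW.
  have : j * (2 * k.+1).+1 <= j * n; last by rewrite leq_pmul2l.
  have [a Da] : exists a, n = j + a by exists (n - j); lia.
  have [b Db] : exists b, k.+1 = j + b by exists (k.+1 - j); lia.
  by move: leW; rewrite Da Db !addKn; lia.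
(* For [k <= 2] at most one part follows [n], and the partition is itself a quasi-star. *)
case: k => [|[|k]] in jk nkj opt_pi n2k *; first by lia.
  have -> : j = 1 by lia.
  exists n, n; split; [by lia | by [] | left].
  by rewrite /qs subnn.
have qs_n2 i : qs n n.-1 i = [:: n; i].
  have n0 : 0 < n by lia.
  by rewrite /qs (prednK n0) -[in n - n.-1](prednK n0) subSnn.
case: k => [|k] in jk nkj opt_pi n2k *.
  exists n.-1, (3 - j); split; [by lia | by lia | left].
  by rewrite qs_n2; move: j j0 jk {nkj opt_pi} => [|[|[|]]].
have sumS m : sumn (stair m.+1) = m.+1 + sumn (stair m) by rewrite stairS.
have [jk' | kj] := ltnP j k.+3; last first.
  have Dj : j = k.+3 by lia.
  case: k => [|k] in jk nkj opt_pi n2k kj Dj *.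
    (* The parts 2, 1 have the same ranks as the single part 3. *)
    exists n.-1, 3; split; [by lia | by lia | left].
    by rewrite qs_n2 Dj ranks_cons ranks_cons perm_cat2l.
  have sq : sumn (qc k.+1 1) + 1 = sumn (stair k.+1) by apply: sumn_qcE.
  (* Row 1 absorbs the last column of the rows below it, rank for rank, and then the bottom cell of
     the preceding column, which gains 3. Since [n > 2 * k + 8], row 1 stays shorter than row 0. *)
  have leW : wt [:: n, 2 * k + 6 & qc k.+1 1] <= wt [:: n, k.+3 & stair k.+2].
    rewrite -stairS -qcSS; rewrite Dj in opt_pi; apply: opt_pi; last first.
      by rewrite /= qcSS (sumS k.+2) (sumS k.+1); lia.
    by rewrite !desc_cons ?(desc_le _ (desc_qc k.+1 1)) //; lia.
  move: leW; rewrite !wt_cons wt_qc // !wt_stair /= (sumS k.+1).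
  have := sumn_iota 1 (2 * k + 6); have := sumn_iota 1 k.+3.
  have := sumn_iota k.+2 k.+2; have := sumn_iota k.+1 k.+1.
  have := sumn_iota k.+1 (k.+1 - 1); rewrite subn1 /=. lia.
have [d Dd] : exists d, k.+3 = j + d by exists (k.+3 - j); lia.
(* The choice is [j - 1], raised to 1 when [j = 1]. The bound [j < c + 2] makes the gain positive;
   [c <= j] keeps the new row 1 shorter than row 0. *)
have [c [c0 cj jc ck]] : exists c, [/\ 0 < c, c <= j, j < c + 2 & c <= k.+1].
  by exists (maxn 1 j.-1); split; lia.
have [f Df] : exists f, k.+1 = c + f by exists (k.+1 - c); lia.
have sq := sumn_qcE ck; have sq' := sumn_qcE jk.
(* With K = k + 3 for the k of the statement: the ranks of the part of column K
   below row 1 are those of the cells continuing row 1; then c cells of column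
   K - 1 are moved behind them, with gain c (c + 2 - j). *)
have leW : wt [:: n, k.+2 + d + c & qc k.+1 c] <= wt (n :: qc k.+3 j).
  apply: opt_pi; last by rewrite /=; move: sq'; rewrite (sumS k.+2) (sumS k.+1); lia.
  by rewrite !desc_cons ?(desc_le _ (desc_qc k.+1 c)) //; lia.
move: leW; rewrite !wt_cons !wt_qc // [stair k.+2]stairS wt_cons wt_stair.
have -> : k.+3 - j = d by lia.
have -> : k.+1 - c = f by lia.
have -> : iota k.+1 k.+1 = iota k.+1 f ++ iota (k.+1 + f) c.
  by rewrite -iotaD addnC -Df.
have -> : iota 1 (k.+2 + d + c) = iota 1 k.+2 ++ iota k.+3 d ++ iota (k.+3 + d) c.
  by rewrite -addnA iotaD iotaD.
rewrite !sumn_cat !(sumn_iotaE _ d) !(sumn_iotaE _ c).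
move: sq'; rewrite /= (sumS k.+2) (sumS k.+1) => sq' leW.
have : c * d <= c * f by lia.
by rewrite leq_pmul2l //; lia.
Qed.

Lemma extremal_compl n pi : desc n pi -> extremal n (compl n pi) -> extremal n pi.
Proof.
move=> d [k [j [jk kn ext]]]; exists k, j; split=> //.
have dqs := desc_qs jk kn; have dqc := desc_le kn (desc_qc k j).
rewrite -(complK d); case: ext => [/perm_ranks_compl H | /perm_ranks_compl H].
  by right; rewrite -(compl_qs jk kn); apply: H; rewrite ?desc_compl.
by left; rewrite -(compl_qc jk kn); apply: H; rewrite ?desc_compl.
Qed.

(** By [wt_compl], the weights of a partition and of its complement differ by an amount depending
    only on [n] and the sum, so a better rival of the complement would yield one of [pi]. *)
Lemma opt_compl n pi : opt n pi -> opt n (compl n pi).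
Proof.
move=> [d opt_pi]; split=> [|sigma dsigma sumE]; first exact: desc_compl.
have := opt_pi _ (desc_compl dsigma).
have := wt_compl d; have := wt_compl dsigma.
have := wt_compl (desc_compl d); have := wt_compl (desc_compl dsigma).
have := sumn_compl d; have := sumn_compl dsigma.
rewrite !complK // sumE => e1 e2 e3 e4 e5 e6 leW.
have {}leW := leW ltac:(lia).
have e : sumn pi = sumn (compl n sigma) by lia.
rewrite e in e4; lia.
Qed.

Lemma opt_behead n pi : desc n pi -> opt n.+1 (n.+1 :: pi) -> opt n pi.
Proof.
move=> d [_ opt_pi]; split=> // sigma dsigma sumE.
have := opt_pi (n.+1 :: sigma); rewrite desc_cons //= sumE => /(_ dsigma erefl).
by rewrite !wt_cons sumE !leq_add2l.
Qed.

Lemma perm_ranks_cons a pi rho :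
  perm_eq (ranks pi) (ranks rho) -> perm_eq (ranks (a :: pi)) (ranks (a :: rho)).
Proof. by move=> eqr; rewrite !ranks_cons perm_cat2l perm_map. Qed.

Lemma perm_ranks_wt pi rho : perm_eq (ranks pi) (ranks rho) -> wt pi = wt rho.
Proof. exact: perm_sumn. Qed.

Lemma perm_ranks_sumn pi rho : perm_eq (ranks pi) (ranks rho) -> sumn pi = sumn rho.
Proof. by move=> /perm_size; rewrite !size_ranks. Qed.

Lemma opt_perm n pi rho : desc n rho -> perm_eq (ranks pi) (ranks rho) ->
  opt n pi -> opt n rho.
Proof.
move=> drho eqr [_ opt_pi]; split=> // sigma dsigma.
by rewrite -(perm_ranks_sumn eqr) -(perm_ranks_wt eqr); apply: opt_pi.
Qed.

Lemma extremal_perm n pi rho : perm_eq (ranks pi) (ranks rho) ->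
  extremal n rho -> extremal n pi.
Proof.
move=> eqr [k [j [jk kn ext]]]; exists k, j; split=> //.
by case: ext => ext; [left | right]; apply: perm_trans ext.
Qed.

Lemma opt_cons_extremal n pi : desc n pi -> 0 < n -> (opt n pi -> extremal n pi) ->
  opt n.+1 (n.+1 :: pi) -> extremal n.+1 (n.+1 :: pi).
Proof.
move=> d n0 IH o; have [k [j [jk kn [ext | ext]]]] := IH (opt_behead d o).
  exists k, j; split=> //; first by lia.
  by left; rewrite qsS //; apply: perm_ranks_cons.
have dqc := desc_le kn (desc_qc k j).
apply: extremal_perm (perm_ranks_cons n.+1 ext) _.
have {}o : opt n.+1 (n.+1 :: qc k j).
  by apply: opt_perm (perm_ranks_cons n.+1 ext) o; rewrite desc_cons.
by have [nkj | nkj] := leqP n.+1 (k + j);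
  [apply: opt_cons_qc_short | apply: opt_cons_qc_long] => //; lia.
Qed.

Lemma opt_extremal n pi : 0 < n -> opt n pi -> extremal n pi.
Proof.
elim: n pi => // n IH pi _ o; have d := o.1.
have topP rho : desc n rho -> opt n.+1 (n.+1 :: rho) -> extremal n.+1 (n.+1 :: rho).
  (* No [k], [j] satisfy [extremal 0], so the induction really starts with the partition
     [[:: 1]]. *)
  case: (posnP n) IH => [-> _ /desc0 -> _ | n0 IH drho]; last first.
    by apply: opt_cons_extremal => //; apply: IH.
  by exists 1, 1; split=> //; left.
have [dn | [pi' Dpi dn]] := descS d; last by rewrite Dpi in o *; apply: topP.
apply: extremal_compl => //; move: (opt_compl o); rewrite compl_skip //.
by apply: topP; apply: desc_compl.
Qed.

(** * Diagonal sequences from ranks *)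

Lemma perm_diag_seq pi rho :
  perm_eq (ranks pi) (ranks rho) -> diag_seq pi = diag_seq rho.
Proof.
have countE sigma i : diag_count sigma i = count_mem i (ranks sigma).
  by rewrite /ranks count_map.
have lengthE sigma : diag_length sigma = \max_(r <- ranks sigma) r.
  by rewrite /ranks big_map.
move=> eqr; rewrite /diag_seq !lengthE (perm_big _ eqr) /=.
by apply: eq_map => i; rewrite !countE; move/seq.permP: eqr.
Qed.

(** * Degrees and edges of threshold graphs *)

Lemma degreeE v (G : sgraph v) x : degree G x = \sum_(y < v) G x y.
Proof. by rewrite /degree -sum1dep_card big_mkcond; apply: eq_bigr => y _; case: ifP. Qed.

(** Handshake lemma: each edge is counted from its smaller and from its larger end. *)
Lemma sum_degree v (G : sgraph v) : \sum_(x < v) degree G x = 2 * num_edges G.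
Proof.
have eE : num_edges G = \sum_(x < v) \sum_(y < v) ((x < y) && G x y).
  rewrite pair_bigA /num_edges -sum1dep_card big_mkcond.
  by apply: eq_bigr => p _; case: ifP.
rewrite mul2n -addnn {1}eE exchange_big eE -big_split; apply: eq_bigr => x _ /=.
rewrite degreeE -big_split; apply: eq_bigr => y _ /=; rewrite (adj_sym G y x).
by case: (ltngtP x y) => [||/val_inj ->]; rewrite ?addn0 //= adj_irr.
Qed.

Lemma th_arc_cons0 a pi t : th_arc (a :: pi) 0 t = (0 < t <= a).
Proof. by []. Qed.

Lemma th_arc_consS a pi s t : th_arc (a :: pi) s.+1 t.+1 = th_arc pi s t.
Proof. by []. Qed.

Lemma th_arc_le n pi s t : desc n pi -> th_arc pi s t -> t <= n.
Proof.
elim: pi n s t => [|a pi IH] n s t; first by rewrite /th_arc nth_nil; lia.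
move=> d; have an : a <= n by move: d; rewrite /desc /=; lia.
move: d; rewrite desc_cons // => /andP [a0 d].
case: s t => [|s] [|t]; rewrite ?th_arc_cons0 ?th_arc_consS //; first by lia.
by move=> /(IH _ _ _ d); lia.
Qed.

Lemma sum_ltn_ord v a : a <= v -> \sum_(x < v) (x < a) = a.
Proof.
move=> av; rewrite -[RHS]card_ord -sum1_card.
rewrite -(big_ord_narrow (F := fun=> 1) av) [RHS]big_mkcond.
by apply: eq_bigr => x _; case: ifP.
Qed.

Lemma degree_Th_cons0 v a pi : a <= v -> degree (Th v.+1 (a :: pi)) ord0 = a.
Proof.
move=> av; rewrite degreeE big_ord_recl adj_irr add0n -[RHS](sum_ltn_ord av).
by apply: eq_bigr => y _ /=; rewrite /th_adj /= orbF.
Qed.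

Lemma degree_Th_consS v a pi (x : 'I_v) :
  degree (Th v.+1 (a :: pi)) (lift ord0 x) = (x < a) + degree (Th v pi) x.
Proof. by rewrite !degreeE big_ord_recl. Qed.

Lemma degree_Th_eq0 n v pi (x : 'I_v) : desc n pi -> n < x -> degree (Th v pi) x = 0.
Proof.
move=> d nx; rewrite degreeE big1 // => y _.
case: (boolP (Th v pi x y)) => // /orP [] xy; have := th_arc_le d xy; last by lia.
by move: xy; rewrite /th_arc; lia.
Qed.

(** Prepending [a] adds a vertex of degree [a] and raises the degrees of the first [a] old vertices
    by 1; the other old vertices are isolated. The old squares thus grow by [a + 4 * sumn pi] in
    total, which agrees with [wt_cons]. *)
Lemma sum_P2_Th n v pi : desc n pi -> n < v ->
  \sum_(x < v) degree (Th v pi) x = 2 * sumn pi /\ P2 (Th v pi) = 2 * wt pi.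
Proof.
elim: pi n v => [|a pi IH] n v d nv.
  have deg0 x : degree (Th v [::]) x = 0.
    rewrite degreeE big1 // => y _ /=; rewrite /th_adj /th_arc !nth_nil.
    by apply/eqP; rewrite eqb0; lia.
  by rewrite /P2 !big1 // => x _; rewrite deg0.
have an : a <= n by move: d; rewrite /desc /=; lia.
move: d; rewrite desc_cons // => /andP [a0 d].
case: v nv => // v nv; have av : a <= v by lia.
have [] := IH _ v d _; first by lia.
rewrite /P2 => sumE P2E; rewrite !big_ord_recl degree_Th_cons0 // wt_cons /=.
split.
  rewrite (eq_bigr _ (fun x _ => degree_Th_consS a pi x)) big_split /=.
  by rewrite sum_ltn_ord // sumE; lia.
pose dg x := degree (Th v pi) x.
rewrite (eq_bigr (fun x : 'I_v => (x < a) + (dg x + dg x) + dg x ^ 2)).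
  rewrite !big_split /= sum_ltn_ord // sumE P2E.
  have := sumn_iota 1 a; lia.
move=> x _; rewrite degree_Th_consS /dg.
have [xa | ax] := ltnP x a; first by lia.
by rewrite (degree_Th_eq0 d) //; lia.
Qed.

Lemma num_edges_Th n v pi : desc n pi -> n < v -> num_edges (Th v pi) = sumn pi.
Proof.
by move=> d nv; have := sum_degree (Th v pi); rewrite (sum_P2_Th d nv).1; lia.
Qed.

Lemma P2_Th n v pi : desc n pi -> n < v -> P2 (Th v pi) = 2 * wt pi.
Proof. by move=> d nv; rewrite (sum_P2_Th d nv).2. Qed.

(** * Isomorphism invariants *)

Lemma isomorphic_degree v (G H : sgraph v) (f : {perm 'I_v}) :
  (forall x y, G x y = H (f x) (f y)) -> forall x, degree G x = degree H (f x).
Proof.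
move=> iso x; rewrite !degreeE [RHS](reindex_inj (@perm_inj _ f)).
by apply: eq_bigr => y _; rewrite iso.
Qed.

Lemma isomorphic_P2 v (G H : sgraph v) : isomorphic G H -> P2 G = P2 H.
Proof.
move=> [f /isomorphic_degree iso]; rewrite /P2 [RHS](reindex_inj (@perm_inj _ f)).
by apply: eq_bigr => x _; rewrite iso.
Qed.

Lemma isomorphic_num_edges v (G H : sgraph v) :
  isomorphic G H -> num_edges G = num_edges H.
Proof.
move=> [f /isomorphic_degree iso]; have := sum_degree H.
by rewrite (reindex_inj (@perm_inj _ f)) -(eq_bigr _ (fun x _ => iso x)) sum_degree; lia.
Qed.

(** * Optimal graphs are threshold graphs *)

Definition pair_rel v (x z : 'I_v) : rel 'I_v :=
  fun a b => ((a == x) && (b == z)) || ((a == z) && (b == x)).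

Lemma pair_relC v (x z : 'I_v) : symmetric (pair_rel x z).
Proof. by move=> a b; rewrite /pair_rel orbC ![(b == _) && _]andbC. Qed.

Lemma sum_eq_ord v (c : 'I_v) (F : 'I_v -> nat) : \sum_(a < v) (a == c) * F a = F c.
Proof.
rewrite -[RHS](big_pred1_eq addn c F) [RHS]big_mkcond.
by apply: eq_bigr => a _; case: eqP; rewrite ?mul1n.
Qed.

Lemma sum_pair_rel v (x z a : 'I_v) : x != z ->
  \sum_(b < v) pair_rel x z a b = (a == x) + (a == z).
Proof.
move=> xz; rewrite (eq_bigr (fun b => (b == z) * (a == x) + (b == x) * (a == z))).
  by rewrite big_split /= (sum_eq_ord z (fun=> _)) (sum_eq_ord x (fun=> _)).
move=> b _; rewrite /pair_rel; have [->|_] := eqVneq a x.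
  by rewrite (negPf xz) muln0 addn0 muln1 orbF.
by case: (a == z); rewrite ?muln0 ?muln1.
Qed.

Definition move_rel v (e : rel 'I_v) (x y z : 'I_v) : rel 'I_v :=
  fun a b => pair_rel x z a b || ~~ pair_rel y z a b && e a b.

Lemma move_rel_sym v (G : sgraph v) x y z : symmetric (move_rel G x y z).
Proof.
by move=> a b; rewrite /move_rel ![pair_rel _ _ a b]pair_relC (adj_sym G a b).
Qed.

Lemma move_rel_irr v (G : sgraph v) x y z : x != z -> irreflexive (move_rel G x y z).
Proof.
move=> xz a; rewrite /move_rel adj_irr andbF orbF /pair_rel.
by have [->|] := eqVneq a x; rewrite ?(negPf xz) ?andbF.
Qed.

(** If xz were not an edge, replacing yz by it would raise [P2] by
    [2 * (degree G x - degree G y) + 2], which is positive. *)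
Lemma optimal_dominates v e (G : sgraph v) (x y z : 'I_v) : optimal e G ->
  degree G y <= degree G x -> G y z -> z != x -> G x z.
Proof.
move=> [<- opt_G] yx Gyz zx; rewrite eq_sym in zx; apply: contraT => nGxz.
have xy : x != y by apply: contraNneq nGxz => ->.
have yz : y != z by apply: contraTneq Gyz => ->; rewrite adj_irr.
pose H := SGraph (@move_rel_sym v G x y z) (@move_rel_irr v G x y z zx).
(* [H] with the edge yz added is [G] with xz added; the contribution of [z] cancels. *)
have degH a : degree H a + (a == y) = degree G a + (a == x).
  apply/eqP; rewrite -(eqn_add2r (a == z)) -!addnA -!sum_pair_rel // !degreeE.
  rewrite -!big_split; apply/eqP/eq_bigr => b _ /=; rewrite /move_rel.
  have [xz_ab | ] := boolP (pair_rel x z a b).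
    have /negPf -> : ~~ pair_rel y z a b.
      move: xz_ab; rewrite /pair_rel => /orP [] /andP [/eqP -> /eqP ->].
        by rewrite (negPf xy) (negPf zx).
      by rewrite (negPf xy) eq_sym (negPf zx) !andbF.
    have /negPf -> // : ~~ G a b.
    by case/orP: xz_ab => /andP [/eqP -> /eqP ->]; rewrite // adj_sym.
  have [yz_ab _ | //] := boolP (pair_rel y z a b).
  have -> // : G a b.
  by case/orP: yz_ab => /andP [/eqP -> /eqP ->]; rewrite // adj_sym.
have eH : num_edges H = num_edges G.
  have : \sum_(a < v) (degree H a + (a == y) * 1) =
         \sum_(a < v) (degree G a + (a == x) * 1).
    by apply: eq_bigr => a _; rewrite !muln1.
  by rewrite !big_split /= !sum_eq_ord !sum_degree; lia.
have := opt_G H eH; rewrite leqNgt => /negP []; rewrite /P2.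
have : \sum_(a < v) (degree H a ^ 2 + (a == y) * (2 * degree G a)) =
       \sum_(a < v) (degree G a ^ 2 + (a == x) * (2 * degree G a + 1) + (a == y) * 1).
  apply: eq_bigr => a _; move: (degH a); have [->|_] := eqVneq a y.
    by rewrite eq_sym (negPf xy); nia.
  by case: (a == x); nia.
by rewrite !big_split /= !sum_eq_ord; lia.
Qed.

(** Nestedness makes the neighbours of 0 an interval 1, ..., [a] containing every endpoint of an
    edge other than 0. Deleting 0 and shifting the labels leaves a relation of the same kind on [a]
    vertices, whose parts are below [a]. *)
Lemma dominating_threshold v (e : rel nat) :
  symmetric e -> irreflexive e -> (forall s t, e s t -> t < v) ->
  (forall s s' t, s < s' -> e s' t -> t != s -> e s t) ->
  exists2 pi, desc v.-1 pi & forall s t, s < t -> e s t = th_arc pi s t.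
Proof.
elim/ltn_ind: v e => v IH e e_sym e_irr e_bnd e_dom.
have [e01 | ne01] := boolP (e 0 1); last first.
  exists [::] => // s t st; rewrite /th_arc nth_nil addn0 ltnNge andNb.
  (* From an edge st, domination by 0 gives the edge 0t, and domination of t by 1 then gives 01. *)
  apply: contraNF ne01 => est.
  have e0t : e 0 t by case: s st est => // s st est; apply: (e_dom 0 s.+1) => //; lia.
  rewrite e_sym; case: t {st est} e0t => [|[|t]]; rewrite ?e_irr // e_sym //.
  by move=> et0; apply: (e_dom 1 t.+2).
have bnd0 t : e 0 t -> t <= v by move=> /e_bnd; lia.
have [a e0a a_max] := ex_maxnP (ex_intro _ 1 e01) bnd0.
have a0 : 0 < a by apply: a_max.
have av := e_bnd _ _ e0a.
have e0E t : 0 < t -> e 0 t = (t <= a).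
  move=> t0; apply/idP/idP => [/a_max // | ]; rewrite leq_eqVlt => /predU1P [-> // | ta].
  by rewrite e_sym; apply: (e_dom t a) => //; [rewrite e_sym | lia].
have [] := IH a av (fun s t => e s.+1 t.+1).
- by move=> s t; apply: e_sym.
- by move=> s; apply: e_irr.
- by move=> s t est; rewrite -e0E //; apply: (e_dom 0 s.+1).
- by move=> s s' t ss' est ts; apply: (e_dom _ s'.+1).
move=> pi d piE; exists (a :: pi); first by rewrite desc_cons ?a0 //; lia.
by case=> [|s] [|t] // st; [rewrite e0E // th_arc_cons0 | rewrite piE].
Qed.

(** Once the vertices are numbered by decreasing degree, [optimal_dominates] provides the
    nestedness. *)
Lemma optimal_threshold v e (G : sgraph v) : 0 < v -> optimal e G ->
  exists2 pi, desc v.-1 pi & isomorphic G (Th v pi).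
Proof.
move=> v0 opt_G; pose x0 : 'I_v := Ordinal v0.
pose r : rel 'I_v := fun x y => degree G y <= degree G x.
have r_tr : transitive r by move=> y x z xy yz; apply: leq_trans yz xy.
have r_tot : total r by move=> x y; apply: leq_total.
pose s := sort r (enum 'I_v).
have s_size : size s = v by rewrite size_sort size_enum_ord.
have g_inj : injective (fun i : 'I_v => nth x0 s i).
  move=> i j /eqP; rewrite nth_uniq ?s_size ?ltn_ord // ?sort_uniq ?enum_uniq //.
  by move/eqP/val_inj.
pose g := perm g_inj.
have g_deg (i j : 'I_v) : i <= j -> degree G (g j) <= degree G (g i).
  move=> ij; rewrite !permE.
  apply: (sorted_leq_nth r_tr _ x0 (sort_sorted r_tot (enum 'I_v))) => //.
  - by move=> x; apply: leqnn.
  - by rewrite inE -/s s_size.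
  - by rewrite inE -/s s_size.
(* The renumbered graph, extended by isolated vertices to all of [nat]. *)
pose e' := fun i j => if insub i is Some x then
  if insub j is Some y then G (g x) (g y) else false else false.
have e'E (x y : 'I_v) : e' x y = G (g x) (g y) by rewrite /e' !valK.
have [] := @dominating_threshold v e'.
- move=> i j; rewrite /e'; case: insub => [x|]; case: insub => // y.
  exact: adj_sym.
- by move=> i; rewrite /e'; case: insub => // x; rewrite adj_irr.
- by move=> i j; rewrite /e'; case: insub => // x; case: insubP.
- move=> i i' j ii'; rewrite /e'; case: (insubP _ i') => // x' i'v Di'.
  case: (insubP _ j) => // y jv Dj Gxy ji.
  case: (insubP _ i) => [x _ Di|]; last by rewrite (ltn_trans ii').
  apply: (optimal_dominates opt_G) Gxy _.
    by apply: g_deg; rewrite Di Di' ltnW.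
  by rewrite (inj_eq perm_inj) -val_eqE Dj Di.
(* [g] sends positions to vertices, so the isomorphism onto [Th v pi] is its inverse. *)
move=> pi d piE; exists pi => //; exists g^-1%g => x y.
rewrite /= /th_adj -{1}(permKV g x) -{1}(permKV g y).
move: (g^-1%g x) (g^-1%g y) => {x y} x y; rewrite -e'E.
case: (ltngtP x y) => [xy | yx | /val_inj ->].
- by rewrite -(piE _ _ xy) [th_arc _ y x]/th_arc [y < x]ltnNge ltnW // orbF.
- by rewrite -(piE _ _ yx) [th_arc _ x y]/th_arc [x < y]ltnNge ltnW //= !e'E adj_sym.
by rewrite e'E adj_irr /th_arc ltnn.
Qed.

(** * Transfer of the extremal partitions back to graphs *)

Theorem theorem1 (v e : nat) (hv : 1 <= v) (he : e <= 'C(v, 2))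
    (G : sgraph v) (hG : optimal e G) :
  exists pi : seq nat,
    [/\ Dis v e pi,
        isomorphic G (Th v pi) &
        (exists2 rho : seq nat, quasi_star v e rho & diag_seq pi = diag_seq rho)
        \/
        (exists2 rho : seq nat, quasi_complete e rho & diag_seq pi = diag_seq rho)].
Proof.
have [pi d iso] := optimal_threshold hv hG.
case: v => // n in hv he G hG d iso *; rewrite /= in d.
have [eG opt_G] := hG.
have sumE : sumn pi = e.
  by rewrite -eG (isomorphic_num_edges iso) (num_edges_Th d).
exists pi; split=> //; first by rewrite /Dis sumE eqxx andbT.
have [n0 | n0] := posnP n.
  (* For a single vertex the empty partition is quasi-complete with [k = j = 1]. *)
  move: d sumE; rewrite n0 => /desc0 -> <-; right; exists [::] => //.
  by exists 1, 1.
have opt_pi : opt n pi.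
  split=> // sigma dsigma sumS; rewrite -(leq_pmul2l (isT : 0 < 2)).
  rewrite -(P2_Th dsigma (ltnSn n)) -(P2_Th d (ltnSn n)) -(isomorphic_P2 iso).
  by apply: opt_G; rewrite (num_edges_Th dsigma) // sumS.
have [k [j [jk kn]]] := opt_extremal n0 opt_pi.
have /andP [j0 _] := jk.
case=> ext; have := perm_ranks_sumn ext; rewrite sumE => sumR; [left | right].
  exists (qs n k j); last exact: perm_diag_seq.
  exists k, j; split=> //; first by rewrite sumR sumn_qs.
  (* The part [j] is positive, which rules out [e = 0] and its separate convention. *)
  by rewrite ifF // sumR /qs sumn_rcons; apply/eqP; lia.
exists (qc k j); last exact: perm_diag_seq.
by exists k, j; split=> //; rewrite sumR sumn_qc.
Qed.
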